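(* For a finite group $G$, consider the functions $A(\mathcal{K}(-)),\,A(\mathcal{L}(-)):\mathrm{Uni}(G)\to\mathrm{Ind}(G)$ sending the class of a $G$-universe $U$ to the indexing system of admissible sets of the Steiner operad $\mathcal{K}(U)$, respectively of the linear isometries operad $\mathcal{L}(U)$. Neither function is a lattice map in general: there is a finite group $G$ for which $A(\mathcal{K}(-))$ is not a lattice map, and there is a finite group $G$ for which $A(\mathcal{L}(-))$ is not a lattice map.
   Context: Let $G$ be a finite group. A $G$-indexing system $\mathcal{I}$ assigns to each subgroup $H\subset G$ a class $\mathcal{I}(H)$ of finite $H$-sets such that: (1) $\mathcal{I}(H)$ contains all finite trivial $H$-sets; (2) $\mathcal{I}(H)$ is closed under isomorphism; (3) if $K\subset H$ and $T\in\mathcal{I}(H)$ then $\mathrm{res}^H_K T\in\mathcal{I}(K)$; (4) if $g\in G$ and $T\in\mathcal{I}(H)$ then the conjugate $gHg^{-1}$-set $c_gT$ lies in $\mathcal{I}(gHg^{-1})$; (5) $\mathcal{I}(H)$ is closed under passage to sub-$H$-sets; (6) $\mathcal{I}(H)$ is closed under binary coproducts; (7) if $K\subset H$, $T\in\mathcal{I}(K)$ and $H/K\in\mathcal{I}(H)$, then $\mathrm{ind}_K^H T\in\mathcal{I}(H)$. $\mathrm{Ind}(G)$ is the poset of $G$-indexing systems under inclusion; it is a finite lattice, with meet the levelwise intersection and join the smallest indexing system containing the levelwise union. A $G$-universe is a countably infinite dimensional real inner product space $U$ with a linear isometric $G$-action, which contains each of its (finite dimensional) subrepresentations infinitely often,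 and which contains trivial summands. $\mathrm{Uni}(G)$ is the set of isomorphism classes $[U]$ of $G$-universes, ordered by $[U]\le[U']$ iff there is a $G$-embedding $U\hookrightarrow U'$. It is a lattice: the join of $[U],[U']$ is $[U\oplus U']$, and the meet is the class of the universe containing infinitely many copies of each irreducible representation that embeds in both $U$ and $U'$. A lattice map is a map preserving binary meets and joins. Linear isometries operad: $\mathcal{L}(U)(n)$ is the $G\times\Sigma_n$-space of all linear, not necessarily equivariant, isometries $U^{\oplus n}\hookrightarrow U$ ($G$ acts by conjugation, $\Sigma_n$ by permuting summands). Steiner operad: for a finite dimensional real orthogonal $G$-representation $V$, let $R_V$ be the $G$-space (under conjugation) of distance-reducing, not necessarily equivariant, embeddings $V\to V$. A $V$-Steiner path is a map $h:[0,1]\to R_V$ with $h(1)=\mathrm{id}$, and $\mathcal{K}(V)(n)$ is the $G\times\Sigma_n$-space of $n$-tuples $(h_1,\dots,h_n)$ of $V$-Steiner paths such that the images of $h_1(0),\dots,h_n(0)$ are disjoint. Set $\mathcal{K}(U)=\mathrm{colim}_{V\subset U}\mathcal{K}(V)$, over finite dimensional subrepresentations $V\subset U$ (for $V\subset W$ one takes the product with the identity on the orthogonal complement of $V$ in $W$). For $\mathcal{O}=\mathcal{K}(U)$ or $\mathcal{L}(U)$, $H\subset G$ and a finite $H$-set $T$, let $\Gamma(T)\subset G\times\Sigma_{|T|}$ be the graph of a permutation representation $H\to\Sigma_{|T|}$ of $T$; $T$ is admissible for $\mathcal{O}$ if $\mathcal{O}(|T|)^{\Gamma(T)}\neq\varnothing$,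 and $A(\mathcal{O})$ is the indexing system of all admissible sets of $\mathcal{O}$. By known theorems of Blumberg and Hill, $H/K$ is admissible for $\mathcal{K}(U)$ iff there is an injective $H$-equivariant map of sets $H/K\hookrightarrow\mathrm{res}^G_HU$, and for $\mathcal{L}(U)$ iff there is an $H$-equivariant linear embedding $\mathrm{ind}_K^H\mathrm{res}^G_KU\hookrightarrow\mathrm{res}^G_HU$. *)

(* Defs.v *)
From HB Require Import structures.
From mathcomp Require Import all_boot all_order all_algebra all_fingroup.
From mathcomp Require Import reals.

Set Implicit Arguments.
Unset Strict Implicit.
Unset Printing Implicit Defensive.

Import Order.TTheory GRing.Theory Num.Theory.

Local Open Scope ring_scope.

(* Left actions, as opposed to the right actions of [action.v].  [hact g] is
   meaningful only for [g \in H]. *)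

Record hset (gT : finGroupType) (H : {group gT}) := HSet {
  hset_sort :> finType;
  hact : gT -> hset_sort -> hset_sort;
  hact1 : hact 1%g =1 id;
  hactM : {in H &, forall g h, hact (g * h)%g =1 hact g \o hact h} }.

Section HSets.
Variable gT : finGroupType.
Implicit Types H K : {group gT}.

Definition hequivariant H (S T : hset H) (f : S -> T) :=
  {in H, forall g x, f (hact g x) = hact g (f x)}.

Definition hset_iso H (S T : hset H) :=
  exists2 f : S -> T, bijective f & hequivariant f.

Definition sub_hset H (S T : hset H) :=
  exists2 f : S -> T, injective f & hequivariant f.

Definition trivial_hset H (T : hset H) :=
  {in H, forall g (x : T), hact g x = x}.

Lemma res_hactM H K (sKH : K \subset H) (T : hset H) :
  {in K &, forall g h, @hact _ _ T (g * h)%g =1 hact g \o hact h}.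
Proof.
move=> g h gK hK.
by apply: hactM; apply: (fintype.subsetP sKH).
Qed.

Definition res_hset H K (sKH : K \subset H) (T : hset H) : hset K :=
  HSet (@hact1 _ _ T) (@res_hactM _ _ sKH T).

(* In MathComp [H :^ x] is [x^-1 H x] and [k ^ g] is [g^-1 k g], so that
   [H :^ g^-1] is [g H g^-1], acting on the set T through [k |-> g^-1 k g]. *)
Lemma conj_hact1 H (g : gT) (T : hset H) : @hact _ _ T (1 ^ g)%g =1 id.
Proof. by move=> x; rewrite conj1g hact1. Qed.

Lemma conj_hactM H (g : gT) (T : hset H) :
  {in (H :^ g^-1)%G &, forall k l,
     @hact _ _ T ((k * l) ^ g)%g =1 hact (k ^ g)%g \o hact (l ^ g)%g}.
Proof.
by move=> k l; rewrite !mem_conjgV => kH lH x; rewrite conjMg hactM.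
Qed.

Definition conj_hset H (g : gT) (T : hset H) : hset (H :^ g^-1)%G :=
  @HSet _ (H :^ g^-1)%G T (fun k => hact (k ^ g)%g)
    (@conj_hact1 H g T) (@conj_hactM H g T).

Definition sum_hact H (S T : hset H) (g : gT) (x : S + T) : S + T :=
  match x with inl s => inl (hact g s) | inr t => inr (hact g t) end.

Lemma sum_hact1 H (S T : hset H) : @sum_hact H S T 1%g =1 id.
Proof. by case=> x /=; rewrite hact1. Qed.

Lemma sum_hactM H (S T : hset H) :
  {in H &, forall g h,
     @sum_hact H S T (g * h)%g =1 sum_hact g \o sum_hact h}.
Proof. by move=> g h gH hH [] x /=; rewrite hactM. Qed.

Definition sum_hset H (S T : hset H) : hset H :=
  HSet (@sum_hact1 H S T) (@sum_hactM H S T).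

Definition orbit_sort H K : finType := {A : {set gT} | A \in lcosets K H}.

Definition orbit_hact H K (g : gT) (A : orbit_sort H K) : orbit_sort H K :=
  insubd A (g *: val A)%g.

Lemma orbit_hact1 H K : @orbit_hact H K 1%g =1 id.
Proof. by move=> A; rewrite /orbit_hact lcoset1 valKd. Qed.

Lemma val_orbit_hact H K g (A : orbit_sort H K) :
  g \in H -> val (orbit_hact g A) = (g *: val A)%g.
Proof.
move=> gH; rewrite val_insubd; case: A => A /= /lcosetsP[x xH ->].
rewrite -lcosetM; case: ifP => // /negP[].
by apply/lcosetsP; exists (g * x)%g; rewrite ?groupM.
Qed.

Lemma orbit_hactM H K :
  {in H &, forall g h, @orbit_hact H K (g * h)%g =1 orbit_hact g \o orbit_hact h}.
Proof.
move=> g h gH hH A; apply: val_inj.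
by rewrite /= !val_orbit_hact ?groupM // lcosetM.
Qed.

Definition orbit_hset H K : hset H :=
  HSet (@orbit_hact1 H K) (@orbit_hactM H K).

(* [ind_class h t] is the class of (h, t) in H x_K T, the quotient of H x T by
   (h k, t) ~ (h, k t) for k in K. *)

Definition ind_class K (T : hset K) (h : gT) (t : T) : {set gT * T} :=
  [set ((h * k)%g, hact k^-1%g t) | k in K].

Definition ind_sort H K (T : hset K) : finType :=
  {B : {set gT * T} | B \in [set ind_class h t | h in H, t in [set: T]]}.

Definition ind_shift K (T : hset K) (g : gT) (B : {set gT * T}) :=
  [set ((g * p.1)%g, p.2) | p in B].

Definition ind_hact H K (T : hset K) (g : gT) (B : ind_sort H T) :
    ind_sort H T :=
  insubd B (ind_shift g (val B)).

Lemma ind_shift_class K (T : hset K) g h (t : T) :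
  ind_shift g (ind_class h t) = ind_class (g * h)%g t.
Proof.
rewrite /ind_shift /ind_class -imset_comp; apply: eq_imset => k /=.
by rewrite mulgA.
Qed.

Lemma ind_hact1 H K (T : hset K) : @ind_hact H K T 1%g =1 id.
Proof.
move=> B; rewrite /ind_hact [ind_shift _ _](_ : _ = val B) ?valKd //.
rewrite /ind_shift -[RHS]imset_id; apply: eq_imset => -[h t] /=.
by rewrite mul1g.
Qed.

Lemma val_ind_hact H K (T : hset K) g (B : ind_sort H T) :
  g \in H -> val (ind_hact g B) = ind_shift g (val B).
Proof.
move=> gH; rewrite val_insubd; case: B => B /= /imset2P[h t hH _ ->].
rewrite ind_shift_class; case: ifP => // /negP[].
by apply/imset2P; exists (g * h)%g t; rewrite ?groupM ?inE.
Qed.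

Lemma ind_hactM H K (T : hset K) :
  {in H &, forall g h, @ind_hact H K T (g * h)%g =1 ind_hact g \o ind_hact h}.
Proof.
move=> g h gH hH B; apply: val_inj.
rewrite /= !val_ind_hact ?groupM // /ind_shift -imset_comp.
by apply: eq_imset => p /=; rewrite mulgA.
Qed.

Definition ind_hset H K (T : hset K) : hset H :=
  HSet (@ind_hact1 H K T) (@ind_hactM H K T).

Definition hset_family := forall H : {group gT}, hset H -> Prop.
Implicit Types I J : hset_family.

Definition family_le I J := forall H (T : hset H), I H T -> J H T.

Definition family_eq I J := forall H (T : hset H), I H T <-> J H T.

Record indexing_system I : Prop := IndexingSystem {
  indexing_trivial : forall H (T : hset H), trivial_hset T -> I H T;
  indexing_iso : forall H (S T : hset H), hset_iso S T -> I H S -> I H T;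
  indexing_res : forall H K (sKH : K \subset H) (T : hset H),
    I H T -> I K (res_hset sKH T);
  indexing_conj : forall H (g : gT) (T : hset H),
    I H T -> I (H :^ g^-1)%G (conj_hset g T);
  indexing_sub : forall H (S T : hset H), sub_hset S T -> I H T -> I H S;
  indexing_sum : forall H (S T : hset H),
    I H S -> I H T -> I H (sum_hset S T);
  indexing_ind : forall H K (T : hset K), K \subset H ->
    I K T -> I H (orbit_hset H K) -> I H (ind_hset H T) }.

Definition ind_meet I J : hset_family := fun H T => I H T /\ J H T.

Definition ind_join I J : hset_family := fun H T =>
  forall M, indexing_system M -> family_le I M -> family_le J M -> M H T.

Lemma indexing_system_meet I J :
  indexing_system I -> indexing_system J -> indexing_system (ind_meet I J).
Proof.
move=> hI hJ; split.
- by move=> H T tT; split; apply: indexing_trivial.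
- by move=> H S T ST [IS JS]; split; apply: indexing_iso ST _.
- by move=> H K sKH T [IT JT]; split; apply: indexing_res.
- by move=> H g T [IT JT]; split; apply: indexing_conj.
- by move=> H S T ST [IT JT]; split; apply: indexing_sub ST _.
- by move=> H S T [IS JS] [IT JT]; split; apply: indexing_sum.
- by move=> H K T sKH [IT JT] [IO JO]; split; apply: indexing_ind.
Qed.

Lemma indexing_system_join I J : indexing_system (ind_join I J).
Proof.
split.
- by move=> H T tT M hM _ _; apply: indexing_trivial.
- by move=> H S T ST jS M hM IM JM; apply: (indexing_iso hM ST); apply: jS.
- by move=> H K sKH T jT M hM IM JM; apply: indexing_res => //; apply: jT.
- by move=> H g T jT M hM IM JM; apply: indexing_conj => //; apply: jT.
- by move=> H S T ST jT M hM IM JM; apply: (indexing_sub hM ST); apply: jT.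
- move=> H S T jS jT M hM IM JM.
  by apply: indexing_sum => //; [apply: jS | apply: jT].
- move=> H K T sKH jT jO M hM IM JM.
  by apply: indexing_ind => //; [apply: jT | apply: jO].
Qed.

End HSets.

Section Subspaces.
Variables (R : realType) (E : lmodType R).

Definition span n (e : 'I_n -> E) (x : E) :=
  exists c : 'I_n -> R, x = \sum_i c i *: e i.

Definition countably_infinite_dimensional :=
  exists e : nat -> E,
    (forall n (c : 'I_n -> R), \sum_i c i *: e i = 0 -> forall i, c i = 0) /\
    (forall x, exists n, span (fun i : 'I_n => e i) x).

End Subspaces.

Record grep (R : realType) (gT : finGroupType) := GRep {
  grep_space :> lmodType R;
  ip : {dot grep_space for idfun};
  gact : gT -> {linear grep_space -> grep_space};
  gact1 : gact 1%g =1 id;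
  gactM : forall g h, gact (g * h)%g =1 gact g \o gact h;
  gact_ip : forall g x y, ip (gact g x) (gact g y) = ip x y }.

Arguments gact {R gT U} _ : rename.

Record subrep (R : realType) (gT : finGroupType) (U : grep R gT) := SubRep {
  subrep_set :> U -> Prop;
  subrep_fin : exists n (e : 'I_n -> U),
    forall x, subrep_set x <-> span e x;
  subrep_stable : forall g x, subrep_set x -> subrep_set (gact g x) }.

Section Universes.
Variables (R : realType) (gT : finGroupType).

(* An equivariant isometric embedding of countably many copies of V in U: the
   copies have pairwise orthogonal images. *)
Definition contains_infinitely_often (U : grep R gT) (V : subrep U) :=
  exists f : nat -> U -> U,
    [/\ forall i a x y, V x -> V y -> f i (a *: x + y) = a *: f i x + f i y,
        forall i g x, V x -> f i (gact g x) = gact g (f i x) &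
        forall i j x y, V x -> V y ->
          ip U (f i x) (f j y) = if i == j then ip U x y else 0].

Record guniverse := GUniverse {
  guniverse_grep :> grep R gT;
  guniverse_dim : countably_infinite_dimensional guniverse_grep;
  guniverse_inf : forall V : subrep guniverse_grep, contains_infinitely_often V;
  guniverse_triv : exists2 x : guniverse_grep, x != 0 &
    forall g, gact g x = x }.

Definition gembedding (U U' : guniverse) (f : {linear U -> U'}) :=
  (forall g x, f (gact g x) = gact g (f x)) /\
  (forall x y, ip U' (f x) (f y) = ip U x y).

Definition gembeds (U U' : guniverse) :=
  exists f : {linear U -> U'}, gembedding f.

Definition giso (U U' : guniverse) :=
  exists2 f : {linear U -> U'}, bijective f & gembedding f.

(* An isomorphism class, represented by the predicate of its members. *)
Record uni := Uni {
  uni_class :> guniverse -> Prop;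
  uni_classP : exists U, forall U', uni_class U' <-> giso U U' }.

Definition uni_le (x y : uni) :=
  exists U U', [/\ x U, y U' & gembeds U U'].

Definition uni_is_join (x y z : uni) :=
  [/\ uni_le x z, uni_le y z &
      forall w, uni_le x w -> uni_le y w -> uni_le z w].

Definition uni_is_meet (x y z : uni) :=
  [/\ uni_le z x, uni_le z y &
      forall w, uni_le w x -> uni_le w y -> uni_le w z].

(* The values of A are meant to be indexing systems.  [ind_meet] and [ind_join]
   are the lattice operations of Ind(G); those of Uni(G) are characterized as
   greatest lower and least upper bounds. *)
Definition lattice_map (A : uni -> hset_family gT) :=
  (forall x y z, uni_is_join x y z ->
     family_eq (A z) (ind_join (A x) (A y))) /\
  (forall x y z, uni_is_meet x y z ->
     family_eq (A z) (ind_meet (A x) (A y))).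

End Universes.

(* Only what the existence of fixed points depends on: the levels of an operad,
   as sets modulo the equivalence [same], with left actions of G x Sigma_n. *)

Record symseq (gT : finGroupType) := SymSeq {
  level :> nat -> Type;
  same : forall n, level n -> level n -> Prop;
  sact : forall n, gT -> 'S_n -> level n -> level n }.

(* The graph of the permutation representation of H on 'I_#|T| obtained by
   transport along [enum_val : 'I_#|T| -> T]. *)
Definition hset_graph (gT : finGroupType) (H : {group gT}) (T : hset H) :
    {set gT * 'S_#|T|} :=
  [set p : gT * 'S_#|T| | (p.1 \in H) &&
     [forall i, enum_val (p.2 i) == hact p.1 (enum_val i)]].

Definition admissible (gT : finGroupType) (O : symseq gT) : hset_family gT :=
  fun H T => exists x : O #|T|,
    {in hset_graph T, forall p, same (sact p.1 p.2 x) x}.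

Section LinearIsometries.
Variables (R : realType) (gT : finGroupType) (U : guniverse R gT).

(* [{ffun 'I_n -> U}] is the n-fold orthogonal direct sum of U. *)
Record linisom n := LinIsom {
  linisom_fun :> {ffun 'I_n -> U} -> U;
  linisom_linear : linear linisom_fun;
  linisom_ip : forall x y,
    ip U (linisom_fun x) (linisom_fun y) = \sum_i ip U (x i) (y i) }.

Definition linisom_act_fun n (g : gT) (s : 'S_n) (f : linisom n)
    (x : {ffun 'I_n -> U}) : U :=
  gact g (f [ffun i => gact g^-1%g (x (s i))]).

Lemma linisom_act_linear n g s (f : linisom n) : linear (linisom_act_fun g s f).
Proof.
move=> a x y; rewrite /linisom_act_fun -linearP -linisom_linear.
by congr (gact g (f _)); apply/ffunP => i; rewrite !ffunE linearP.
Qed.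

Lemma linisom_act_ip n g s (f : linisom n) x y :
  ip U (linisom_act_fun g s f x) (linisom_act_fun g s f y) =
  \sum_i ip U (x i) (y i).
Proof.
rewrite gact_ip linisom_ip [RHS](reindex_inj (@perm_inj _ s)) /=.
by apply: eq_bigr => i _; rewrite !ffunE gact_ip.
Qed.

Definition linisom_act n g s (f : linisom n) : linisom n :=
  LinIsom (linisom_act_linear g s f) (linisom_act_ip g s f).

Definition linear_isometries : symseq gT :=
  @SymSeq gT linisom (fun _ f f' => f =1 f') linisom_act.

End LinearIsometries.

Section Steiner.
Variables (R : realType) (gT : finGroupType) (U : guniverse R gT).
Implicit Types V W : subrep U.

Definition unorm (x : U) : R := Num.sqrt (ip U x x).

(* Elements of R_V are represented by functions [U -> U] whose values outside
   of V are irrelevant.  The last field says that the inverse of f on its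
   image is continuous. *)
Record dr_embedding V (f : U -> U) : Prop := DREmbedding {
  dr_maps : forall x, V x -> V (f x);
  dr_lipschitz : forall x y, V x -> V y -> unorm (f x - f y) <= unorm (x - y);
  dr_inj : forall x y, V x -> V y -> f x = f y -> x = y;
  dr_homeo : forall x, V x -> forall e : R, 0 < e ->
    exists2 d : R, 0 < d & forall y, V y ->
      unorm (f x - f y) < d -> unorm (x - y) < e }.

(* Continuity is for the compact-open topology on R_V, that is, uniform
   convergence on the bounded subsets of the finite dimensional space V. *)
Record steiner_path V (h : R -> U -> U) : Prop := SteinerPath {
  path_emb : forall t, 0 <= t <= 1 -> dr_embedding V (h t);
  path_cont : forall s, 0 <= s <= 1 -> forall r e : R, 0 < e ->
    exists2 d : R, 0 < d & forall t, 0 <= t <= 1 -> `|t - s| < d ->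
      forall x, V x -> unorm x <= r -> unorm (h t x - h s x) < e;
  path_end : forall x, V x -> h 1 x = x }.

Record steiner_tuple V n (h : 'I_n -> R -> U -> U) : Prop := SteinerTuple {
  tuple_path : forall i, steiner_path V (h i);
  tuple_disjoint : forall i j x y, i != j -> V x -> V y ->
    h i 0 x != h j 0 y }.

(* k is the image of h under the map K(V)(n) -> K(W)(n) *)
Definition steiner_extends V W n (h k : 'I_n -> R -> U -> U) :=
  forall i t v w, 0 <= t <= 1 -> V v -> W w ->
    (forall x, V x -> ip U x w = 0) -> k i t (v + w) = h i t v + w.

(* The disjoint union over V of the K(V)(n); the colimit K(U)(n) is its quotient
   by [steiner_same]. *)
Record steiner n := Steiner {
  steiner_rep : subrep U;
  steiner_fun : 'I_n -> R -> U -> U;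
  steinerP : steiner_tuple steiner_rep steiner_fun }.

Definition steiner_same n (x y : steiner n) :=
  exists W (k : 'I_n -> R -> U -> U),
    [/\ forall v, steiner_rep x v \/ steiner_rep y v -> W v,
        steiner_tuple W k,
        steiner_extends (steiner_rep x) W (steiner_fun x) k &
        steiner_extends (steiner_rep y) W (steiner_fun y) k].

Definition steiner_act_fun n (g : gT) (s : 'S_n) (h : 'I_n -> R -> U -> U) :=
  fun i t x => gact g (h (s^-1%g i) t (gact g^-1%g x)).

Lemma gactK g : cancel (@gact _ _ U g) (gact g^-1%g).
Proof. by move=> x; rewrite -[LHS]/((gact _ \o gact _) x) -gactM mulVg gact1. Qed.

Lemma gactKV g : cancel (@gact _ _ U g^-1%g) (gact g).
Proof. by move=> x; rewrite -[LHS]/((gact _ \o gact _) x) -gactM mulgV gact1. Qed.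

Lemma unorm_gact g (x : U) : unorm (gact g x) = unorm x.
Proof. by rewrite /unorm gact_ip. Qed.

Lemma unorm_gactB g (x y : U) : unorm (gact g x - gact g y) = unorm (x - y).
Proof. by rewrite -linearB unorm_gact. Qed.

Lemma steiner_act_tuple V n g s (h : 'I_n -> R -> U -> U) :
  steiner_tuple V h -> steiner_tuple V (steiner_act_fun g s h).
Proof.
rewrite /steiner_act_fun => -[hp hd].
have VV := @subrep_stable _ _ _ V; split=> [i|i j x y ij Vx Vy].
  have [he hc h1] := hp (s^-1%g i); split=> [t t01|t0 t01 r e e0|x Vx].
  - have [em el ei eh] := he t t01; split.
    + by move=> x Vx; apply/VV/em/VV.
    + move=> x y Vx Vy; rewrite unorm_gactB -(unorm_gactB g^-1%g x y).
      by apply: el; apply: VV.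
    + move=> x y Vx Vy /(can_inj (gactK g)) e.
      by apply: (can_inj (gactK g^-1)); apply: ei e; apply: VV.
    + move=> x Vx e e0; have [d d0 dP] := eh _ (VV g^-1%g _ Vx) e e0.
      exists d => // y Vy; rewrite unorm_gactB -(unorm_gactB g^-1%g x y).
      by apply: dP; apply: VV.
  - have [d d0 dP] := hc t0 t01 r e e0; exists d => // t t1 td x Vx xr.
    by rewrite unorm_gactB dP ?unorm_gact //; apply: VV.
  - by rewrite h1 ?gactKV //; apply: VV.
rewrite (can_eq (gactK g)); apply: hd; [|exact: VV|exact: VV].
by rewrite (inj_eq perm_inj).
Qed.

Definition steiner_act n g s (x : steiner n) : steiner n :=
  Steiner (steiner_act_tuple g s (steinerP x)).

Definition steiner_operad : symseq gT :=
  @SymSeq gT steiner steiner_same steiner_act.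

End Steiner.

(* Admissible for some representative U of the class x, equivalently for all of
   them, since isomorphic universes have isomorphic operads. *)

Definition admissible_steiner (R : realType) (gT : finGroupType)
    (x : uni R gT) : hset_family gT :=
  fun H T => exists2 U, x U & admissible (steiner_operad U) T.

Definition admissible_linear_isometries (R : realType) (gT : finGroupType)
    (x : uni R gT) : hset_family gT :=
  fun H T => exists2 U, x U & admissible (linear_isometries U) T.

(* Main.v *)
Require Import Defs.
From HB Require Import structures.
From mathcomp Require Import all_boot all_order all_algebra all_fingroup.
From mathcomp Require Import reals.
From mathcomp Require Import ring lra.

(** Both functions already fail to preserve meets for the Klein four-group.

    Let [a] and [b] be the two coordinate characters of the Klein four-group with
    values in the signs, and let [U_a] be the universe that is the sum of
    infinitely many copies of the trivial representation and of [a]; define [U_b]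
    likewise.  The only irreducible representation common to both is the trivial
    one, so the meet of [U_a] and [U_b] is the trivial universe
    ([sign_universe_meet]).  On the diagonal subgroup [D], however, [a] and [b]
    restrict to the same nontrivial character, and [U_a] and [U_b] become
    isomorphic to the complete universe of a group of order 2.  The free orbit of
    [D] is therefore admissible for both universes and both operads
    ([sign_hset_admissible_steiner], [sign_hset_admissible_linear_isometries]),
    whereas over the trivial universe only the trivial sets are admissible
    ([steiner_not_admissible], [linear_isometries_not_admissible]).  So the
    intersection of the two indexing systems is not the indexing system of the
    meet.

    The universe of a character is realized on real polynomials, the monomials
    being orthonormal: group elements with sign -1 act by the substitution of
    [- 'X] for ['X].  Even monomials are then fixed and odd ones carry the
    character, and the isometries are built from injective maps on
    exponents. *)

Set Implicit Arguments.
Unset Strict Implicit.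
Unset Printing Implicit Defensive.

(* [gact], also the name of a projection of [groupAction], is the action on a
   universe from here on. *)
Import Defs.
Import Order.TTheory GRing.Theory Num.Theory.
Local Open Scope ring_scope.

(** * The space of polynomials with orthonormal monomials *)

Section CoefDot.
Variable R : realType.
Implicit Types p q : {poly R}.

Definition coef_dot p q : R := \sum_(i < size p) p`_i * q`_i.

(** Any bound on the size may replace the size itself; this is what makes the
    formula usable for two polynomials of different sizes. *)
Lemma coef_dotE n p q :
  (size p <= n)%N -> coef_dot p q = \sum_(i < n) p`_i * q`_i.
Proof.
move=> le_pn; rewrite /coef_dot (big_ord_widen _ (fun i => p`_i * q`_i) le_pn).
rewrite big_mkcond; apply: eq_bigr => i _; case: ltnP => // le_pi.
by rewrite nth_default ?mul0r.
Qed.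

Lemma coef_dotC p q : coef_dot p q = coef_dot q p.
Proof.
rewrite (coef_dotE q (leq_maxl _ (size q))) (coef_dotE p (leq_maxr (size p) _)).
by apply: eq_bigr => i _; rewrite mulrC.
Qed.

Lemma coef_dot_linearr p a q q' :
  coef_dot p (a *: q + q') = a * coef_dot p q + coef_dot p q'.
Proof.
rewrite mulr_sumr -big_split; apply: eq_bigr => i _ /=.
by rewrite coefD coefZ mulrDr mulrCA.
Qed.

Lemma coef_dot_bilinear :
  bilinear_for (GRing.Scale.Law.clone _ _ *%R _)
               (GRing.Scale.Law.clone _ _ (idfun \; *%R) _) coef_dot.
Proof.
split=> [q|p] a u v; last by rewrite coef_dot_linearr.
by rewrite coef_dotC coef_dot_linearr 2!(coef_dotC q).
Qed.

HB.instance Definition _ :=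
  bilinear_isBilinear.Build R {poly R} {poly R} R *%R (idfun \; *%R) coef_dot
    coef_dot_bilinear.

Lemma coef_dot_hermitian p q :
  coef_dot p q = (-1) ^+ false * idfun (coef_dot q p).
Proof. by rewrite mul1r coef_dotC. Qed.

HB.instance Definition _ :=
  isHermitianSesquilinear.Build R {poly R} false idfun coef_dot
    coef_dot_hermitian.

Lemma coef_dot_gt0 p : p != 0 -> 0 < coef_dot p p.
Proof.
rewrite -lead_coef_eq0 => p0; have sp : (0 < size p)%N.
  by rewrite lt0n size_poly_eq0 -lead_coef_eq0.
rewrite /coef_dot -(ltn_predK sp) big_ord_recr /= ltr_wpDl //.
  by apply: sumr_ge0 => i _; rewrite -expr2 sqr_ge0.
by rewrite -expr2 exprn_even_gt0.
Qed.

HB.instance Definition _ :=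
  isDotProduct.Build R {poly R} coef_dot coef_dot_gt0.

Definition coef_ip : {dot {poly R} for idfun} := coef_dot.

Lemma coef_dotXn i j : coef_dot 'X^i 'X^j = (i == j)%:R.
Proof.
rewrite /coef_dot size_polyXn big_ord_recr /= big1 ?add0r.
  by rewrite !coefXn eqxx mul1r.
by move=> k _; rewrite coefXn ltn_eqF ?mul0r.
Qed.
End CoefDot.

(** * Monomial maps and dilations *)

Section Relabel.
Variable R : realType.
Implicit Types p q : {poly R}.
Implicit Types phi psi : nat -> nat.

(** The linear map carrying the orthonormal basis element ['X^i] to
    ['X^(phi i)].  It is an isometry when [phi] is injective, and universes will
    be embedded in each other, and in themselves, by such maps. *)
Definition relabel phi p : {poly R} := \sum_(i < size p) p`_i *: 'X^(phi i).

Lemma relabelE n phi p :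
  (size p <= n)%N -> relabel phi p = \sum_(i < n) p`_i *: 'X^(phi i).
Proof.
move=> le_pn; rewrite /relabel.
rewrite (big_ord_widen _ (fun i => p`_i *: 'X^(phi i)) le_pn) big_mkcond.
apply: eq_bigr => i _; case: ltnP => // le_pi.
by rewrite nth_default ?scale0r.
Qed.

Lemma relabel_linear phi : linear (relabel phi).
Proof.
move=> a p q; pose n := maxn (size p) (size q).
have sp : (size p <= n)%N by apply: leq_maxl.
have sq : (size q <= n)%N by apply: leq_maxr.
have sz : (size (a *: p + q : {poly R})%R <= n)%N.
  apply: leq_trans (size_polyD _ _) _; rewrite geq_max sq andbT.
  exact: leq_trans (size_scale_leq _ _) sp.
rewrite (relabelE phi sp) (relabelE phi sq) (relabelE phi sz).
rewrite scaler_sumr -big_split; apply: eq_bigr => i _ /=.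
by rewrite coefD coefZ scalerDl scalerA.
Qed.

HB.instance Definition _ phi :=
  GRing.isLinear.Build R {poly R} {poly R} *:%R (relabel phi)
    (relabel_linear phi).

Lemma relabel_dot_disjoint phi psi p q :
  (forall i j, phi i != psi j) -> coef_dot (relabel phi p) (relabel psi q) = 0.
Proof.
move=> dis; rewrite linear_sumlz big1 // => i _.
rewrite linear_sumr big1 // => j _.
by rewrite linearZr linearZl /= coef_dotXn (negPf (dis i j)) !mulr0.
Qed.

Lemma relabel_dot phi p q :
  injective phi -> coef_dot (relabel phi p) (relabel phi q) = coef_dot p q.
Proof.
move=> inj_phi; pose n := maxn (size p) (size q).
rewrite (relabelE phi (leq_maxr (size p) (size q))) -/n linear_sumr.
rewrite coef_dotC (coef_dotE p (leq_maxr (size p) (size q))).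
apply: eq_bigr => i _; rewrite linearZr /=; congr (_ * _).
rewrite /relabel linear_sumlz.
under eq_bigr => j _ do rewrite linearZl /= coef_dotXn (inj_eq inj_phi).
case: (ltnP i (size p)) => [ip | le_pi].
  rewrite (bigD1 (Ordinal ip)) //= eqxx mulr1 big1 ?addr0 // => j.
  by rewrite -val_eqE /= => /negPf ->; rewrite mulr0.
rewrite nth_default // big1 // => j _.
by rewrite (ltn_eqF (leq_trans (ltn_ord j) le_pi)) mulr0.
Qed.

Definition dilate (c : R) p : {poly R} := \poly_(i < size p) (c ^+ i * p`_i).

Lemma coef_dilate c p i : (dilate c p)`_i = c ^+ i * p`_i.
Proof. by rewrite coef_poly; case: ltnP => // ?; rewrite nth_default ?mulr0. Qed.

Lemma dilate_linear c : linear (dilate c).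
Proof.
move=> a p q; apply/polyP => i.
by rewrite coefD coefZ !coef_dilate coefD coefZ mulrDr mulrCA.
Qed.

HB.instance Definition _ c :=
  GRing.isLinear.Build R {poly R} {poly R} *:%R (dilate c) (dilate_linear c).

Lemma dilate1 : dilate 1 =1 id.
Proof. by move=> p; apply/polyP => i; rewrite coef_dilate expr1n mul1r. Qed.

Lemma dilateM c d p : dilate (c * d) p = dilate c (dilate d p).
Proof. by apply/polyP => i; rewrite !coef_dilate exprMn mulrA. Qed.

Lemma dilateXn c n : dilate c 'X^n = c ^+ n *: 'X^n.
Proof.
apply/polyP => i; rewrite coef_dilate coefZ coefXn.
by case: eqVneq => [->|_]; rewrite ?mulr0.
Qed.

Lemma dilateX c k : dilate c (k *: 'X) = (c * k) *: 'X.
Proof. by rewrite linearZ /= -['X]expr1 dilateXn expr1 scalerA mulrC. Qed.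

Lemma dilate_dot (b : bool) p q :
  coef_dot (dilate ((-1) ^+ b) p) (dilate ((-1) ^+ b) q) = coef_dot p q.
Proof.
have le_n r : (size (dilate ((-1) ^+ b) r) <= size r)%N by apply: size_poly.
rewrite (coef_dotE _ (le_n p)); apply: eq_bigr => i _.
rewrite !coef_dilate mulrACA -exprD addnn -exprM.
by rewrite -signr_odd oddM odd_double andbF mul1r.
Qed.

(** The map induced by [phi] intertwines two dilations up to the scalar [e] as
    soon as it does so on exponents.  With signs for [c] and [d] this only
    involves the parity of [phi], and it is the source of all the equivariance
    statements about monomial maps. *)
Lemma dilate_relabel c d e phi p : (forall i, c ^+ phi i = e * d ^+ i) ->
  dilate c (relabel phi p) = e *: relabel phi (dilate d p).
Proof.
move=> h; have le_n : (size (dilate d p) <= size p)%N by apply: size_poly.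
rewrite (relabelE _ le_n) /relabel raddf_sum scaler_sumr.
apply: eq_bigr => i _; rewrite [LHS]linearZ [LHS]/= dilateXn coef_dilate h.
rewrite !scalerA.
by congr (_ *: _); rewrite mulrC mulrA.
Qed.
End Relabel.

(** * The universe of a sign character *)

Section SignUniverse.
Variables (R : realType) (gT : finGroupType) (chi : gT -> bool).
Hypothesis chiM : {morph chi : g h / (g * h)%g >-> g (+) h}.

Lemma sign_char1 : chi 1%g = false.
Proof. by have := chiM 1%g 1%g; rewrite mulg1 addbb. Qed.

(** The even monomials carry the trivial representation and the odd ones the
    sign representation given by [chi], each infinitely often. *)
Definition sign_act (g : gT) : {linear {poly R} -> {poly R}} :=
  dilate ((-1) ^+ chi g).

Lemma sign_act1 : sign_act 1%g =1 id.
Proof. by move=> p; rewrite /sign_act sign_char1 /= dilate1. Qed.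

Lemma sign_actM g h : sign_act (g * h)%g =1 sign_act g \o sign_act h.
Proof. by move=> p; rewrite /sign_act chiM signr_addb /= dilateM. Qed.

Lemma sign_act_ip g p q :
  coef_ip R (sign_act g p) (sign_act g q) = coef_ip R p q.
Proof. exact: dilate_dot. Qed.

Definition sign_rep : grep R gT := GRep sign_act1 sign_actM sign_act_ip.

Lemma sign_rep_dim : countably_infinite_dimensional sign_rep.
Proof.
exists (fun n => 'X^n : {poly R}); split=> [n c c0 i | p].
  move/(congr1 (fun p : {poly R} => p`_i)): c0.
  rewrite coef0 coef_sum (bigD1 i) //= coefZ coefXn eqxx mulr1.
  rewrite big1 ?addr0 // => j ji.
  by rewrite coefZ coefXn eq_sym (negPf (ji : val j != val i)) mulr0.
exists (size (p : {poly R})), (fun i => (p : {poly R})`_i).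
by rewrite -poly_def coefK.
Qed.

(** Injective in both arguments together and preserving the parity of [m]: the
    [i]-th copy of the universe inside itself is spread along these
    exponents, so that the copies are equivariant and pairwise orthogonal. *)
Definition copy_index (i m : nat) : nat := (pickle (i, m)).*2 + odd m.

Lemma odd_copy_index i m : odd (copy_index i m) = odd m.
Proof. by rewrite oddD odd_double oddb. Qed.

Lemma copy_index_inj i j m n :
  copy_index i m = copy_index j n -> i = j /\ m = n.
Proof.
move=> e; have := congr1 odd e; rewrite !odd_copy_index => o.
move: e; rewrite /copy_index o => /addIn/double_inj/(pcan_inj pickleK).
by case.
Qed.

(** The embeddings are restrictions of embeddings of the whole universe, hence
    do not depend on [V]. *)
Lemma sign_rep_inf (V : subrep sign_rep) : contains_infinitely_often V.
Proof.
exists (fun i => relabel (copy_index i)); split=> [i a x y _ _|i g x _|].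
- exact: relabel_linear.
- rewrite /= /sign_act (@dilate_relabel _ _ ((-1) ^+ chi g) 1) ?scale1r // => m.
  rewrite mul1r -!exprM -signr_odd oddM odd_copy_index.
  by rewrite -[RHS]signr_odd oddM.
- move=> i j x y _ _; case: eqVneq => [-> | ij].
    by apply: relabel_dot => m n /copy_index_inj[].
  apply: relabel_dot_disjoint => m n.
  by apply: contra_neqN ij => /eqP/copy_index_inj[].
Qed.

Lemma sign_rep_triv : exists2 x : sign_rep, x != 0 & forall g, gact g x = x.
Proof.
exists (1 : {poly R}); first exact: oner_neq0.
by move=> g; rewrite /= /sign_act -(expr0 'X) dilateXn expr0 scale1r.
Qed.

Definition sign_universe : guniverse R gT :=
  GUniverse sign_rep_dim sign_rep_inf sign_rep_triv.
End SignUniverse.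

(** * Isomorphism classes of universes and their order *)

Section Classes.
Variables (R : realType) (gT : finGroupType).
Implicit Types U V W : guniverse R gT.

Lemma ip_eq0 (E : grep R gT) (x : E) : ip E x x = 0 -> x = 0.
Proof.
by have [//|/(@neq0_dnorm_gt0 _ _ _ (ip E)) + e] := eqVneq x 0; rewrite e ltxx.
Qed.

Lemma giso_refl U : giso U U.
Proof. by exists idfun; [exists idfun | split]. Qed.

Lemma gembeds_trans V U W : gembeds U V -> gembeds V W -> gembeds U W.
Proof.
move=> [f [fG fI]] [h [hG hI]]; exists (h \o f); split=> [g x|x y] /=.
  by rewrite fG hG.
by rewrite hI fI.
Qed.

Lemma giso_gembeds U V : giso U V -> gembeds U V.
Proof. by case=> f _ fE; exists f. Qed.

Lemma giso_gembeds_inv U V : giso U V -> gembeds V U.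
Proof.
case=> f [h fK hK] [fG fI].
have h_lin : linear h.
  by move=> a x y; apply: (can_inj fK); rewrite linearP !hK.
pose hl := GRing.isLinear.Build _ _ _ _ h h_lin.
pose hL : {linear V -> U} := HB.pack h hl.
exists hL; split=> [g x|x y] /=.
  by apply: (can_inj fK); rewrite fG !hK.
by rewrite -fI !hK.
Qed.

Lemma uni_of_subproof U : exists V, forall W, giso U W <-> giso V W.
Proof. by exists U. Qed.

Definition uni_of U : uni R gT := Uni (uni_of_subproof U).

(** The order relates some representatives; since isomorphisms are invertible
    embeddings, it then relates all of them. *)
Lemma uni_le_ofP U (w : uni R gT) :
  uni_le w (uni_of U) -> forall W, w W -> gembeds W U.
Proof.
move=> [W0 [U' [wW0 UU' emb]]] W wW; have [W1 w_iso] := uni_classP w.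
move/w_iso: wW => /giso_gembeds_inv W_W1; move/w_iso: wW0 => /giso_gembeds W1_W0.
apply: gembeds_trans W_W1 (gembeds_trans W1_W0 _).
exact: gembeds_trans emb (giso_gembeds_inv UU').
Qed.

Lemma uni_le_of U V : gembeds U V -> uni_le (uni_of U) (uni_of V).
Proof. by exists U, V; split => //; apply: giso_refl. Qed.

Lemma uni_rep (w : uni R gT) : exists W, w W.
Proof. by have [W wW] := uni_classP w; exists W; apply/wW/giso_refl. Qed.

Lemma uni_of_act_trivial U V (g : gT) :
  gact g =1 (@id U) -> uni_of U V -> gact g =1 (@id V).
Proof.
move=> gU [f [h fK hK] [fG _]] x.
by rewrite -[x]hK -fG gU.
Qed.

End Classes.

(** * The meet of two sign universes *)

Section Meet.
Variables (R : realType) (gT : finGroupType).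
Implicit Types chi : gT -> bool.

Lemma false_charM : {morph (fun _ : gT => false) : g h / (g * h)%g >-> g (+) h}.
Proof. by []. Qed.

Definition trivial_universe := sign_universe R false_charM.

Lemma trivial_universe_act g : gact g =1 (@id trivial_universe).
Proof. exact: dilate1. Qed.

Lemma sign_universe_act chi (chiM : {morph chi : g h / (g * h)%g >-> g (+) h}) g :
  chi g = false -> gact g =1 (@id (sign_universe R chiM)).
Proof. by move=> chig p; rewrite /= /sign_act chig; apply: dilate1. Qed.

Lemma trivial_gembeds chi (chiM : {morph chi : g h / (g * h)%g >-> g (+) h}) :
  gembeds trivial_universe (sign_universe R chiM).
Proof.
exists (relabel double : {linear {poly R} -> {poly R}}); split=> [g x|x y].
  rewrite trivial_universe_act /= /sign_act (@dilate_relabel _ _ 1 1).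
    by rewrite scale1r dilate1.
  by move=> i; rewrite expr1n -exprM -signr_odd oddM odd_double andbF mulr1.
exact/relabel_dot/double_inj.
Qed.

(** Isometric maps are injective, so triviality of the action of [g] passes to
    subuniverses. *)
Lemma gembeds_act_trivial (U V : guniverse R gT) g :
  gembeds U V -> gact g =1 (@id V) -> gact g =1 (@id U).
Proof.
move=> [f [fG fI]] gV x; apply/eqP; rewrite -subr_eq0; apply/eqP/ip_eq0.
by rewrite -fI linearB fG gV subrr linear0l.
Qed.

Variables a b : gT -> bool.
Hypothesis aM : {morph a : g h / (g * h)%g >-> g (+) h}.
Hypothesis bM : {morph b : g h / (g * h)%g >-> g (+) h}.
Hypothesis ker_gen : forall g, exists2 h, a h = false & b (h^-1 * g)%g = false.

(** A universe [W] below both sign universes is fixed by [ker a] and by [ker b],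
    which together generate the group, so its action is trivial.  The trivial
    universe has the same underlying inner product space as the sign universe of
    [a], hence the embedding of [W] in the latter is also an equivariant
    embedding in the former. *)
Lemma sign_universe_meet :
  uni_is_meet (uni_of (sign_universe R aM)) (uni_of (sign_universe R bM))
              (uni_of trivial_universe).
Proof.
split; [exact/uni_le_of/trivial_gembeds | exact/uni_le_of/trivial_gembeds |].
move=> w wa wb; have [W wW] := uni_rep w.
have Wa := uni_le_ofP wa wW; have Wb := uni_le_ofP wb wW.
have W_triv g : gact g =1 (@id W).
  have [h ah bh] := ker_gen g => x; rewrite -(mulKVg h g) gactM /=.
  rewrite (gembeds_act_trivial Wb (sign_universe_act bh)).
  exact: (gembeds_act_trivial Wa (sign_universe_act ah)).
exists W, trivial_universe; split => //; first exact: giso_refl.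
have [f [_ fI]] := Wa; exists (f : {linear W -> {poly R}}); split=> [g x|x y].
  by rewrite trivial_universe_act W_triv.
by rewrite -fI.
Qed.
End Meet.

(** * An element acting trivially obstructs admissibility *)

Section Obstruction.
Variables (R : realType) (gT : finGroupType).
Implicit Types (H : {group gT}) (U : guniverse R gT).

Lemma hset_graphP H (T : hset H) g (s : 'S_#|T|) :
  reflect (g \in H /\ forall i, enum_val (s i) = hact g (enum_val i))
          ((g, s) \in hset_graph T).
Proof.
rewrite inE /=; apply: (iffP andP) => -[gH].
  by move/forallP => e; split=> // i; apply/eqP.
by move=> e; split=> //; apply/forallP => i; apply/eqP.
Qed.

Lemma hset_graph_perm H (T : hset H) g :
  g \in H -> exists s : 'S_#|T|, (g, s) \in hset_graph T.
Proof.
move=> gH.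
have inj : injective (fun i : 'I_#|T| => enum_rank (hact g (enum_val i))).
  move=> i j /enum_rank_inj /(congr1 (hact g^-1%g)).
  have hK (x : T) : hact g^-1%g (hact g x) = x.
    by rewrite -[RHS]hact1 -(mulVg g) hactM ?groupV.
  by rewrite !hK => /enum_val_inj.
by exists (perm inj); apply/hset_graphP; split=> // i; rewrite permE enum_rankK.
Qed.

Lemma subrep0 U (V : subrep U) : V 0.
Proof.
have [n [e eP]] := subrep_fin V; apply/eP; exists (fun=> 0).
by rewrite big1 // => i _; rewrite scale0r.
Qed.

(** If [g] fixes [U] pointwise, invariance under the graph says that [g] merely
    permutes the Steiner paths.  Two paths that it exchanges would agree, but
    their images at time 0 are disjoint.  They are compared at the origin, which
    lies in every subrepresentation and is unaffected by the extension to a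
    larger one. *)
Lemma steiner_not_admissible U H (T : hset H) g (x : T) :
  g \in H -> gact g =1 (@id U) -> hact g x != x ->
  ~ admissible (steiner_operad U) T.
Proof.
move=> gH gU gx [[V h hP] /= fixed].
have [s sg] := hset_graph_perm T gH; have [_ sE] := hset_graphP _ _ sg.
have [W [k [sVW _ /= ext1 ext2]]] := fixed _ sg.
pose i := s (enum_rank x).
have V0 := subrep0 V; have W0 := subrep0 W.
have t0 : (0 : R) <= 0 <= (1 : R) by rewrite lexx ler01.
have orth y : V y -> ip U y 0 = 0 by rewrite linear0r.
have := ext1 i 0 0 0 t0 V0 W0 orth; rewrite (ext2 i 0 0 0 t0 V0 W0 orth).
rewrite /steiner_act_fun gU linear0 /i permK !addr0; apply/eqP.
apply: (tuple_disjoint hP _ V0 V0).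
apply: contra gx => /eqP e.
by rewrite -[x in X in X == _]enum_rankK -sE e enum_rankK.
Qed.

(** If [g] fixes [U] pointwise, an isometry fixed by the graph takes the same
    value on a tuple and on the permuted tuple.  A tuple supported at [x] is moved
    to an orthogonal one; as inner products are preserved, it would be orthogonal
    to itself. *)
Lemma linear_isometries_not_admissible U H (T : hset H) g (x : T) :
  g \in H -> gact g =1 (@id U) -> hact g x != x ->
  ~ admissible (linear_isometries U) T.
Proof.
move=> gH gU gx [f fixed].
have [s sg] := hset_graph_perm T gH; have [_ sE] := hset_graphP _ _ sg.
have gVU : gact g^-1%g =1 (@id U) by move=> y; rewrite -{1}[y]gU gactK.
have [w w0 _] := guniverse_triv U; apply/(negP w0)/eqP/ip_eq0.
pose j := enum_rank x; pose y := [ffun i => if i == j then w else 0 : U].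
have sum_y (z : {ffun 'I_#|T| -> U}) : \sum_i ip U (z i) (y i) = ip U (z j) w.
  rewrite (bigD1 j) //= big1 ?addr0 ?ffunE ?eqxx // => i /negPf ij.
  by rewrite ffunE ij linear0r.
have sj : s j != j.
  apply: contra gx => /eqP e.
  by rewrite -[x in hact _ x]enum_rankK -sE e enum_rankK.
have := fixed _ sg y; rewrite /= /linisom_act_fun gU => fE.
have := linisom_ip f y y; rewrite -{1}fE linisom_ip !sum_y !ffunE eqxx gVU.
by rewrite (negPf sj) linear0l.
Qed.

End Obstruction.

(** * The two-element set with the sign action *)

Section SignSet.
Variables (gT : finGroupType) (H : {group gT}) (a : gT -> bool).
Hypothesis aM : {morph a : g h / (g * h)%g >-> g (+) h}.

Definition sign_hact (g : gT) (x : bool) : bool := a g (+) x.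

Lemma sign_hact1 : sign_hact 1%g =1 id.
Proof. by move=> x; rewrite /sign_hact (sign_char1 aM). Qed.

Lemma sign_hactM :
  {in H &, forall g h, sign_hact (g * h)%g =1 sign_hact g \o sign_hact h}.
Proof. by move=> g h _ _ x; rewrite /sign_hact aM /= addbA. Qed.

Definition sign_hset : hset H := HSet sign_hact1 sign_hactM.

Lemma sign_hset_graph g (s : 'S_#|sign_hset|) :
  (g, s) \in hset_graph sign_hset ->
  g \in H /\
  forall b : sign_hset, s (enum_rank b) = enum_rank (a g (+) b : sign_hset).
Proof.
move/hset_graphP => [gH sE]; split=> // b; apply: enum_val_inj.
by rewrite sE !enum_rankK.
Qed.
End SignSet.

Section Admissible.
Variables (R : realType) (gT : finGroupType) (H : {group gT}).
Variables chi a : gT -> bool.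
Hypothesis chiM : {morph chi : g h / (g * h)%g >-> g (+) h}.
Hypothesis aM : {morph a : g h / (g * h)%g >-> g (+) h}.
Hypothesis chi_a : {in H, chi =1 a}.

Local Notation U := (sign_universe R chiM).
Local Notation T := (sign_hset H aM).

Lemma sign_charV g : chi g^-1%g = chi g.
Proof.
have := chiM g^-1%g g; rewrite mulVg (sign_char1 chiM).
by case: (chi _); case: (chi _).
Qed.

(** ** Admissibility for the linear isometries operad *)

Section Isometry.
Let c : R := (Num.sqrt 2)^-1.
Let even_copy : {linear {poly R} -> {poly R}} := relabel double.
Let odd_copy : {linear {poly R} -> {poly R}} := relabel (fun i => i.*2.+1).
Let flip : {linear {poly R} -> {poly R}} := dilate (-1).
Let coord (b : bool) (x : {ffun 'I_#|T| -> U}) : {poly R} :=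
  x (enum_rank (b : T)).

(** An element of sign -1 acts on the sum of two copies of [U] by applying [flip]
    and exchanging the summands.  Its eigenspaces for 1 and -1 consist of the
    pairs [(u, flip u)] and [(u, - flip u)], which are sent isometrically to the
    even and to the odd part of [U]; [c] normalizes the two projections. *)
Definition fold_isometry (x : {ffun 'I_#|T| -> U}) : U :=
  even_copy (c *: (coord false x + flip (coord true x))) +
  odd_copy (c *: (coord false x - flip (coord true x))).

Lemma fold_isometry_linear : linear fold_isometry.
Proof.
move=> k x y.
have coordP b : coord b (k *: x + y) = k *: coord b x + coord b y.
  by rewrite /coord !ffunE.
have comb (L : {linear {poly R} -> {poly R}}) p q p' q' :
    L (c *: (k *: p + q + (k *: p' + q'))) =
    k *: L (c *: (p + p')) + L (c *: (q + q')).
  rewrite addrACA -(scalerDr k) (scalerDr c) [LHS]linearD; congr (_ + _).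
  by rewrite scalerA mulrC -scalerA linearZ.
rewrite /fold_isometry !coordP (linearP flip) comb opprD -scalerN comb.
by rewrite addrACA -(scalerDr k).
Qed.

Lemma fold_isometry_ip x y :
  ip U (fold_isometry x) (fold_isometry y) = \sum_i ip U (x i) (y i).
Proof.
have -> : \sum_i ip U (x i) (y i) =
    \sum_(b : bool) coef_dot (coord b x) (coord b y).
  rewrite (reindex (fun b : bool => enum_rank (b : T))) //=.
  exact/onW_bij/(@enum_rank_bij T).
rewrite big_bool /=; set p := coord false x; set q := coord true x.
set p' := coord false y; set q' := coord true y.
have even_odd u v : coef_dot (even_copy u) (odd_copy v) = 0.
  apply: relabel_dot_disjoint => i j.
  by apply/eqP => /(congr1 odd); rewrite /= !odd_double.
have even_even u v : coef_dot (even_copy u) (even_copy v) = coef_dot u v.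
  exact/relabel_dot/double_inj.
have odd_odd u v : coef_dot (odd_copy u) (odd_copy v) = coef_dot u v.
  by apply: relabel_dot => i j [/double_inj].
have c2 : c * c = 2^-1 by rewrite -invfM -expr2 sqr_sqrtr.
have flip_flip u v : coef_dot (flip u) (flip v) = coef_dot u v.
  exact: (dilate_dot true).
rewrite -(flip_flip q) -[LHS]/(coef_dot (_ + _) (_ + _)) -/p -/q -/p' -/q'.
move: (flip q) (flip q') => r r'.
rewrite linearDl !linearDr /= even_even odd_odd even_odd.
rewrite (coef_dotC (odd_copy _)) even_odd addr0 add0r.
have scale u v : coef_dot (c *: u) (c *: v) = 2^-1 * coef_dot u v.
  by rewrite linearZl linearZr /= mulrA c2.
rewrite !scale !(linearDl, linearDr, linearNl, linearNr) /=.
by field.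
Qed.

Definition fold_linisom : linisom U #|T| :=
  LinIsom fold_isometry_linear fold_isometry_ip.

Lemma sign_hset_admissible_linear_isometries :
  admissible (linear_isometries U) T.
Proof.
exists fold_linisom => -[g s] /sign_hset_graph[gH sE] y.
rewrite /= /linisom_act_fun /= /fold_isometry /coord !ffunE !sE.
rewrite /= /sign_act -/U sign_charV (chi_a gH).
have flipK p : flip (flip p) = p
  by rewrite /flip /= -dilateM mulrNN mulr1 dilate1.
have flip_even p : flip (even_copy p) = even_copy p.
  rewrite /flip /= (@dilate_relabel _ _ 1 1) ?scale1r ?dilate1 // => i.
  by rewrite expr1n -signr_odd odd_double mulr1.
have flip_odd p : flip (odd_copy p) = - odd_copy p.
  rewrite /flip /= (@dilate_relabel _ _ 1 (-1)) ?scaleN1r ?dilate1 // => i.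
  by rewrite expr1n -signr_odd /= odd_double mulr1.
case: (a g) => /=; last by rewrite !dilate1.
(* the coordinates (u, v) become (flip v, flip u): the sum u + flip v is kept,
   and the change of sign of u - flip v is undone by flip on the odd part *)
have swap u v : flip (even_copy (c *: (flip v + flip (flip u))) +
                      odd_copy (c *: (flip v - flip (flip u)))) =
    even_copy (c *: (u + flip v)) + odd_copy (c *: (u - flip v)).
  rewrite linearD flip_even flip_odd flipK addrC [u + _]addrC.
  by rewrite -linearN -scalerN opprB addrC.
exact: swap.
Qed.
End Isometry.

(** ** A pair of Steiner paths of the line exchanged by the sign *)

Section Paths.
Implicit Types t x y z : R.

(** For [0 <= t] a distance-reducing embedding of the line: the identity at
    [t = 0], and with image the interval between -1 and 1 at [t = 1]. *)
Definition damp t x : R := x / (1 + t * `|x|).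

Lemma damp_den t x : 0 <= t -> 0 < 1 + t * `|x|.
Proof. by move=> t0; rewrite ltr_pwDl // mulr_ge0. Qed.

Lemma damp_odd t x : damp t (- x) = - damp t x.
Proof. by rewrite /damp normrN mulNr. Qed.

(** The lower bound gives injectivity, the upper one that distances do not
    increase. *)
Lemma damp_mono t x y : 0 <= t -> x < y -> 0 < damp t y - damp t x <= y - x.
Proof.
move=> t0 xy; have dx := damp_den x t0; have dy := damp_den y t0.
have -> : damp t y - damp t x = 
  (y - x + t * (y * `|x| - x * `|y|)) / ((1 + t * `|y|) * (1 + t * `|x|)).
  by rewrite /damp; field; rewrite !gt_eqF.
have num : 0 <= y * `|x| - x * `|y| <= (y - x) * (`|x| + `|y|).
  by case: (ger0P x) => hx; case: (ger0P y) => hy; apply/andP; split; nra.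
rewrite divr_gt0 ?mulr_gt0 //=; last first.
  by rewrite ltr_pwDl ?subr_gt0 // mulr_ge0 //; case/andP: num.
rewrite ler_pdivrMr ?mulr_gt0 //.
have : t * (y * `|x| - x * `|y|) <= t * ((y - x) * (`|x| + `|y|)).
  by apply: ler_wpM2l => //; case/andP: num.
have : 0 <= (y - x) * (t * `|y| * (t * `|x|)).
  by rewrite !mulr_ge0 // subr_ge0 ltW.
lra.
Qed.

Lemma damp_time s t x r : 0 <= s -> 0 <= t -> `|x| <= r ->
  `|damp t x - damp s x| <= `|t - s| * r ^+ 2.
Proof.
move=> s0 t0 xr; have dt := damp_den x t0; have ds := damp_den x s0.
have -> : damp t x - damp s x =
  (s - t) * (x * `|x|) / ((1 + t * `|x|) * (1 + s * `|x|)).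
  by rewrite /damp; field; rewrite !gt_eqF.
rewrite !normrM normr_id (distrC s) normfV ler_pdivrMr; last first.
  by rewrite normr_gt0 gt_eqF // mulr_gt0.
rewrite (gtr0_norm (mulr_gt0 dt ds)) -expr2 -mulrA ler_wpM2l //.
apply: (@le_trans _ _ (r ^+ 2));
  first by rewrite lerXn2r ?nnegrE // (le_trans _ xr).
rewrite ler_peMr ?sqr_ge0 //.
by rewrite mulr_ege1 // lerDl mulr_ge0.
Qed.

(** The path that moves the damped line, centred at [2 * e] when [t = 0], back to
    the identity when [t = 1].  The centre at distance 2 keeps the images of
    the paths for [e = 1] and [e = -1] on opposite sides of the origin. *)
Definition drift (e t x : R) : R := 2 * e * (1 - t) + damp (1 - t) x.

Lemma driftN e t x : drift (- e) t (- x) = - drift e t x.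
Proof. by rewrite /drift damp_odd; ring. Qed.

Lemma drift1 e x : drift e 1 x = x.
Proof. by rewrite /drift /damp subrr mulr0 add0r mul0r addr0 divr1. Qed.

Lemma drift0_sign (b : bool) x : 0 < (-1) ^+ b * drift ((-1) ^+ b) 0 x.
Proof.
wlog -> : b x / b = false.
  case: b => [/(_ false (- x) erefl) | ]; last by apply.
  by rewrite expr1 expr0 mulN1r mul1r -[X in drift X _]opprK driftN.
rewrite expr0 mul1r /drift /damp subr0 !mulr1 mul1r.
have den : 0 < 1 + `|x| by rewrite ltr_pwDl.
rewrite -ltrBlDl sub0r ltr_pdivlMr //.
by have := ler_norm (- x); rewrite normrN; lra.
Qed.

Lemma drift_mono e t x y : t <= 1 -> x < y ->
  0 < drift e t y - drift e t x <= y - x.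
Proof.
move=> t1 xy; have := @damp_mono (1 - t) x y; rewrite subr_ge0 => /(_ t1 xy).
by rewrite /drift opprD addrACA subrr add0r.
Qed.

Lemma drift_lipschitz e t x y : t <= 1 ->
  `|drift e t x - drift e t y| <= `|x - y|.
Proof.
move=> t1; wlog xy : x y / x < y.
  move=> wl; case: (ltgtP x y) => [/wl//|/wl|->]; last by rewrite !subrr.
  by rewrite distrC [leRHS]distrC.
rewrite distrC [leRHS]distrC; have /andP[pos le] := drift_mono e t1 xy.
by rewrite (gtr0_norm pos) gtr0_norm // subr_gt0.
Qed.

Lemma drift_le e t x y : t <= 1 -> x <= y -> drift e t x <= drift e t y.
Proof.
move=> t1; rewrite le_eqVlt => /predU1P[-> // | /(drift_mono e t1)/andP[+ _]].
by rewrite subr_gt0 => /ltW.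
Qed.

Lemma drift_inj e t : t <= 1 -> injective (drift e t).
Proof.
move=> t1 x y exy; case: (ltgtP x y) => // /(drift_mono e t1).
  by rewrite exy subrr ltxx.
by rewrite exy subrr ltxx.
Qed.

(** A strictly increasing function has a continuous inverse: to stay within [eps]
    of [x] it suffices that the value stays between those at [x - eps] and
    [x + eps]. *)
Lemma drift_homeo e t x eps : t <= 1 -> 0 < eps ->
  exists2 d, 0 < d &
    forall y, `|drift e t x - drift e t y| < d -> `|x - y| < eps.
Proof.
move=> t1 eps0.
have /(drift_mono e t1)/andP[up _] : x < x + eps by rewrite ltrDl.
have /(drift_mono e t1)/andP[dn _] : x - eps < x by rewrite gtrBl.
exists (Num.min (drift e t (x + eps) - drift e t x)
                (drift e t x - drift e t (x - eps))).
  by rewrite lt_min up.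
move=> y; rewrite lt_min => /andP[du dd].
rewrite distrC ltr_distl; apply/andP; split; rewrite ltNge; apply/negP.
  move/(drift_le e t1) => h.
  by have := le_lt_trans (ler_norm _) dd; rewrite ltrD2l ltrN2; lra.
move/(drift_le e t1) => h.
by rewrite distrC in du; have := le_lt_trans (ler_norm _) du; lra.
Qed.

Lemma drift_time (b : bool) s t x r : s <= 1 -> t <= 1 -> `|x| <= r ->
  `|drift ((-1) ^+ b) t x - drift ((-1) ^+ b) s x| <= `|t - s| * (2 + r ^+ 2).
Proof.
move=> s1 t1 xr; rewrite /drift opprD addrACA.
have ts : 1 - t - (1 - s) = s - t by ring.
apply: le_trans (ler_normD _ _) _; rewrite [leRHS]mulrDr; apply: lerD.
  rewrite -mulrBr ts !normrM normr_sign mulr1 mulrC distrC.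
  by rewrite (gtr0_norm (ltr0Sn _ _)).
have := @damp_time (1 - s) (1 - t) x r; rewrite !subr_ge0 => /(_ s1 t1 xr).
by rewrite ts (distrC s).
Qed.

End Paths.

(** ** Admissibility for the Steiner operad *)

Section Steiner.

Lemma line_fin : exists n (e : 'I_n -> U),
  forall x, (exists k : R, x = k *: ('X : {poly R})) <-> span e x.
Proof.
exists 1%N, (fun=> 'X : {poly R}) => x; split=> [[k ->] | [k ->]].
  by exists (fun=> k); rewrite big_ord1.
by exists (k ord0); rewrite big_ord1.
Qed.

Lemma line_stable g (x : U) : (exists k : R, x = k *: ('X : {poly R})) ->
  exists k : R, gact g x = k *: ('X : {poly R}).
Proof.
by move=> [k ->]; exists ((-1) ^+ chi g * k); rewrite -dilateX.
Qed.

(** A copy of the sign representation in [U], spanned by the monomial of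
    degree 1. *)
Definition line : subrep U := SubRep line_fin line_stable.

Lemma unorm_line (k : R) : unorm (k *: 'X : U) = `|k|.
Proof.
rewrite /unorm -sqrtr_sqr -[ip U _ _]/(coef_dot (k *: 'X) (k *: 'X)).
by rewrite linearZl linearZr /= -['X]expr1 coef_dotXn mulr1 expr2.
Qed.

Definition line_path (i : 'I_#|T|) (t : R) (p : U) : U :=
  drift ((-1) ^+ (enum_val i : bool)) t (p : {poly R})`_1 *: 'X.

Lemma line_path_tuple : steiner_tuple line line_path.
Proof.
have coefX1 (k : R) : (k *: 'X : {poly R})`_1 = k by rewrite coefZ coefX mulr1.
split=> [i | i j _ _ ij [k ->] [l ->]]; last first.
  rewrite /line_path !coefX1; apply/eqP => /(congr1 (fun p : {poly R} => p`_1)).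
  rewrite !coefX1 => e.
  have := drift0_sign (enum_val i) k; have := drift0_sign (enum_val j) l.
  rewrite e; move: ij; rewrite -(inj_eq enum_val_inj).
  by case: (enum_val i) (enum_val j) => -[] //= _; rewrite ?expr0 ?expr1; lra.
rewrite /line_path; set b : bool := enum_val i.
split=> [t /andP[t0 t1] | s /andP[s0 s1] r e e0 | _ [k ->]].
- split=> [_ [k ->] | _ _ [k ->] [l ->] | _ _ [k ->] [l ->] | _ [k ->] e e0].
  + by eexists.
  + by rewrite !coefX1 -!scalerBl !unorm_line drift_lipschitz.
  + rewrite !coefX1 => /(congr1 (fun p : {poly R} => p`_1)).
    by rewrite !coefX1 => /(drift_inj t1) ->.
  + have [d d0 dP] := drift_homeo ((-1) ^+ b) k t1 e0; exists d => // _ [l ->].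
    by rewrite !coefX1 -!scalerBl !unorm_line; apply: dP.
- have r0 : 0 < 2 + r ^+ 2 by rewrite ltr_pwDl ?sqr_ge0.
  exists (e / (2 + r ^+ 2)); first exact: divr_gt0.
  move=> t /andP[t0 t1] ts _ [k ->].
  rewrite !coefX1 -!scalerBl !unorm_line => kr.
  by apply: le_lt_trans (drift_time b s1 t1 kr) _; rewrite -ltr_pdivlMr.
- by rewrite coefX1 drift1.
Qed.

(** The sign representation contains the free orbit of a nonzero vector; the two
    paths start around its points, and the symmetry [driftN] of the drift makes
    them exchanged by the sign. *)
Lemma sign_hset_admissible_steiner : admissible (steiner_operad U) T.
Proof.
exists (Steiner line_path_tuple) => -[g s] /sign_hset_graph[gH sE] /=.
have extends h : (forall i t v, line v -> line_path i t v = h i t v) ->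
    steiner_extends line line h line_path.
  move=> e i t v w _ Vv Vw orth.
  by rewrite (ip_eq0 (orth w Vw)) !addr0 e.
exists line, line_path; split=> /= [v [] // | | |]; first exact: line_path_tuple.
- apply: extends => i t _ [k ->].
  have ei : (enum_val i : bool) = a g (+) enum_val (s^-1%g i).
    by rewrite -{1}[i](permKV s) -[(s^-1%g i)]enum_valK sE !enum_rankK.
  rewrite /steiner_act_fun /line_path ei /= /sign_act sign_charV (chi_a gH).
  rewrite !(dilateX, coefZ, coefX, mulr1); congr (_ *: _).
  case: (a g); rewrite /= ?addFb ?expr0 ?mul1r // signrN.
  by rewrite expr1 !mulN1r -driftN opprK.
- exact: extends.
Qed.
End Steiner.
End Admissible.

(** * The Klein four-group *)

Section Failure.
Variable R : realType.

Local Notation gT := ('Z_2 * 'Z_2)%type.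

Definition fst_sign (g : gT) : bool := g.1 != 0.
Definition snd_sign (g : gT) : bool := g.2 != 0.

Lemma Z2_neq0D (x y : 'Z_2) : (x + y != 0) = (x != 0) (+) (y != 0).
Proof. by case: x y => [[|[|?]] ?] [[|[|?]] ?]. Qed.

Lemma fst_signM : {morph fst_sign : g h / (g * h)%g >-> g (+) h}.
Proof. by move=> g h; apply: Z2_neq0D. Qed.

Lemma snd_signM : {morph snd_sign : g h / (g * h)%g >-> g (+) h}.
Proof. by move=> g h; apply: Z2_neq0D. Qed.

Lemma diagonal_group_set : group_set [set g | fst_sign g == snd_sign g].
Proof.
apply/group_setP; split=> [|g h]; first by rewrite inE.
by rewrite !inE fst_signM snd_signM => /eqP -> /eqP ->.
Qed.

(** The subgroup on which the two characters agree and are nontrivial. *)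
Definition diagonal : {group gT} := Group diagonal_group_set.

Definition diagonal_set : hset diagonal := sign_hset diagonal fst_signM.

Definition diagonal_gen : gT := (1, 1)%R.

Let Ua := sign_universe R fst_signM.
Let Ub := sign_universe R snd_signM.
Let U1 := trivial_universe R gT.

Lemma not_lattice_map_of (A : uni R gT -> hset_family gT) :
  A (uni_of Ua) diagonal diagonal_set -> A (uni_of Ub) diagonal diagonal_set ->
  ~ A (uni_of U1) diagonal diagonal_set -> ~ lattice_map A.
Proof.
move=> Aa Ab A1 [_ meet]; apply: A1.
apply/(meet (uni_of Ua) (uni_of Ub)); last by split.
apply: sign_universe_meet => g; exists (1%g, g.2); first by [].
by rewrite /snd_sign /= mulVg.
Qed.

Lemma diagonal_gen_moves (b : diagonal_set) : hact diagonal_gen b != b.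
Proof. by case: b. Qed.

Lemma diagonal_genP : diagonal_gen \in diagonal.
Proof. by rewrite inE. Qed.

End Failure.

Theorem proposition2p7 (R : realType) :
  (exists gT : finGroupType, ~ lattice_map (@admissible_steiner R gT)) /\
  (exists gT : finGroupType,
     ~ lattice_map (@admissible_linear_isometries R gT)).
Proof.
have fst_fst : {in diagonal, fst_sign =1 fst_sign} by [].
have snd_fst : {in diagonal, snd_sign =1 fst_sign}.
  by move=> g; rewrite inE => /eqP ->.
have triv U := @uni_of_act_trivial R _ _ U diagonal_gen (trivial_universe_act _).
split; exists ('Z_2 * 'Z_2)%type; apply: not_lattice_map_of.
- by eexists; [exact: giso_refl | exact: sign_hset_admissible_steiner].
- by eexists; [exact: giso_refl | exact: sign_hset_admissible_steiner].
- move=> [U /triv U_triv]; apply: steiner_not_admissible diagonal_genP U_triv _.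
  exact: (diagonal_gen_moves false).
- by eexists; [exact: giso_refl |
    exact: sign_hset_admissible_linear_isometries].
- by eexists; [exact: giso_refl |
    exact: sign_hset_admissible_linear_isometries].
- move=> [U /triv U_triv].
  apply: linear_isometries_not_admissible diagonal_genP U_triv _.
  exact: (diagonal_gen_moves false).
Qed.
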